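(* Let $G$ be a finite simple graph with $m$ edges that is not a complete graph, let $\lambda_1\ge\lambda_2\ge\dots\ge\lambda_n$ be the eigenvalues of its adjacency matrix, and let $\omega(G)$ be its clique number. Then $$\lambda_1^2+\lambda_2^2\ \le\ \left(1-\frac{1}{\omega(G)+50\,\omega(G)^{5/6}}\right)2m .$$
   Context: Graphs are finite and simple with at least one vertex; eigenvalues are listed with multiplicity. The clique number is the maximum number of pairwise adjacent vertices. *)

(* Defs.v *)
From HB Require Import structures.
From mathcomp Require Import all_boot all_order all_algebra.
From mathcomp Require Import complex.
Set Implicit Arguments.
Unset Strict Implicit.
Unset Printing Implicit Defensive.
Import Order.TTheory GRing.Theory Num.Theory.
Local Open Scope ring_scope.

Section Graph.
Variables (T : finType) (e : rel T).

Definition simple_graph := symmetric e /\ irreflexive e.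

Definition complete_graph := forall x y : T, x != y -> e x y.

Definition edges : {set {set T}} :=
  [set A : {set T} | [exists x, exists y, e x y && (A == [set x; y])]].

Definition clique (Q : {set T}) : bool :=
  [forall x in Q, forall y in Q, (x != y) ==> e x y].

Definition clique_number : nat := (\max_(Q : {set T} | clique Q) #|Q|)%N.

(* Vertices are indexed by their position in [enum T]. *)
Definition adjmx (R : pzRingType) : 'M[R]_#|T| :=
  \matrix_(i, j) (e (enum_val i) (enum_val j))%:R.

End Graph.

(* [s] lists the eigenvalues with algebraic multiplicity, in nonincreasing
   order; it is unique, has size [n], and exists whenever [A] is symmetric
   ([eigenvalue_list_exists]). *)
Definition eigenvalue_list (R : realFieldType) (n : nat) (A : 'M[R]_n)
    (s : seq R) : Prop :=
  sorted >=%R s /\ char_poly A = \prod_(x <- s) ('X - x%:P).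

Lemma eigenvalue_list_exists (R : rcfType) (n : nat) (A : 'M[R]_n) :
  A^T = A -> exists s, eigenvalue_list A s.
Proof.
move=> symA; pose f := real_complex R; pose B := map_mx f A.
have herB : B \is hermsymmx.
  apply/is_hermitianmxP; rewrite expr0 scale1r.
  apply/matrixP=> i j; rewrite !mxE -[in LHS]symA mxE.
  by apply/esym/CrealP; rewrite complex_real.
have /orthomx_spectralP B_eq := hermitian_normalmx herB.
have /mxOverP dreal := hermitian_spectral_diag_real herB.
set P := spectralmx B in B_eq; set d := spectral_diag B in B_eq dreal.
have uP : P \in unitmx by exact: spectral_unit.
pose r := [seq complex.Re (d 0 i) | i : 'I_n].
have dE i : d 0 i = f (complex.Re (d 0 i)).
  by rewrite /f (RRe_real (dreal 0 i)).
exists (sort >=%R r); split.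
  by apply: sort_sorted => x y; apply: le_total.
have -> : \prod_(x <- sort >=%R r) ('X - x%:P) =
          \prod_(x <- r) ('X - x%:P) :> {poly R}.
  by apply: perm_big; rewrite perm_sort.
apply: (map_poly_inj f); rewrite map_char_poly -/B rmorph_prod big_map /=.
have -> : char_poly B = char_poly (diag_mx d).
  rewrite B_eq /char_poly /char_poly_mx !map_mxM /=.
  have uPX : map_mx polyC P \in unitmx by rewrite unitmxE det_map_mx rmorph_unit -?unitmxE.
  set D := map_mx polyC (diag_mx d); rewrite map_invmx.
  have -> : 'X%:M - invmx (map_mx polyC P) *m D *m map_mx polyC P =
            invmx (map_mx polyC P) *m ('X%:M - D) *m map_mx polyC P.
    by rewrite mulmxBr mulmxBl scalar_mxC -(mulmxA 'X%:M) mulVmx // mulmx1.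
  by rewrite !det_mulmx mulrAC -det_mulmx mulVmx // det1 mul1r.
rewrite char_poly_trig ?diag_mx_is_trig // big_enum /=.
by apply: eq_bigr => i _; rewrite mxE eqxx dE map_polyXsubC.
Qed.

(* Main.v *)
(* Let u >= 0 (Perron) and v be orthonormal eigenvectors for l1 >= l2 >= 0, put
   p_i = (sqrt l1 u_i, sqrt l2 v_i) and X_ij = <p_i, p_j>.  The sum of X over
   ordered adjacent pairs and the sum S of X^2 over all pairs both equal
   l1^2 + l2^2, so by AM-GM it suffices that the squared positive entries of X
   at adjacent pairs sum to at most (1 - 1/k) S, where
   k = omega + 50 omega^(5/6) = omega (1 + 50 h) and h = omega^(-1/6).

   If the p_i all lie in one quadrant, X^2 is a sum of rank-one nonnegative
   kernels f_i f_j, and Motzkin-Straus applied to each f shows that non-adjacent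
   pairs carry at least S/omega.  In general the p_i lie in a half-plane.  If
   h >= 3/50, splitting it into two quadrants loses only a factor 4.  If h is
   small, cut off a fraction h of the weight at each angular end: either the
   remaining sector is wider than a right angle by an angle of sine >= h^2, and
   the pairs of opposite ends carry squared negative mass at least S/omega, or it
   is almost a quadrant, and rounding the p_i into a quadrant costs only a
   relative error O(h). *)
Require Import Defs.
From mathcomp Require Import all_boot all_order all_algebra.
From mathcomp Require Import all_classical all_reals all_analysis.
From mathcomp Require Import complex ring lra.
Set Implicit Arguments.
Unset Strict Implicit.
Unset Printing Implicit Defensive.
Import Order.TTheory GRing.Theory Num.Theory.
Local Open Scope ring_scope.

(** * The Motzkin-Straus inequality *)

Lemma sqr_sum_le_card (R : realFieldType) (T : finType) (A : {set T})
    (f : T -> R) :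
  (\sum_(i in A) f i) ^+ 2 <= #|A|%:R * \sum_(i in A) f i ^+ 2.
Proof.
set S := \sum_(i in A) f i; set Q := \sum_(i in A) f i ^+ 2.
have eS2 : S ^+ 2 = \sum_(i in A) \sum_(j in A) f i * f j.
  by rewrite expr2 mulr_suml; apply: eq_bigr => i _; rewrite mulr_sumr.
have eQ : \sum_(i in A) \sum_(j in A) (f i ^+ 2 / 2 + f j ^+ 2 / 2) = #|A|%:R * Q.
  under eq_bigr => i _ do rewrite big_split /= sumr_const -mulr_suml.
  by rewrite big_split /= sumr_const sumrMnl -mulr_suml -/Q -!(mulr_natl (_ / 2)); field.
rewrite eS2 -eQ; apply: ler_sum => i _; apply: ler_sum => j _.
have := sqr_ge0 (f i - f j); lra.
Qed.

Lemma card_clique_le (T : finType) (e : rel T) (Q : {set T}) :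
  clique e Q -> (#|Q| <= clique_number e)%N.
Proof. exact: leq_bigmax_cond. Qed.

Lemma clique_number_gt0 (T : finType) (e : rel T) :
  (0 < #|T|)%N -> (0 < clique_number e)%N.
Proof.
case/card_gt0P=> x _; rewrite -(cards1 x); apply: card_clique_le.
apply/forall_inP=> y /set1P->; apply/forall_inP=> z /set1P->.
by rewrite eqxx.
Qed.

(* Motzkin-Straus: for non-adjacent [i != j] the right-hand side is affine along
   [delta_i - delta_j], so the weight of one of them can be moved onto the other
   until the support is a clique. *)
Lemma motzkin_straus (R : realFieldType) (T : finType) (e : rel T)
    (f : T -> R) :
    simple_graph e -> (forall i, 0 <= f i) ->
  (\sum_i f i) ^+ 2
    <= (clique_number e)%:R * \sum_i \sum_(j | ~~ e i j) f i * f j.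
Proof.
move=> [syme irre].
pose N i j : R := (~~ e i j)%:R.
have NE (g h : T -> R) :
    \sum_i \sum_(j | ~~ e i j) g i * h j = \sum_i \sum_j N i j * (g i * h j).
  apply: eq_bigr => i _; rewrite big_mkcond /=; apply: eq_bigr => j _.
  by rewrite /N; case: (~~ e i j); rewrite ?mul1r ?mul0r.
have [n] := ubnP #|[set i | f i != 0]|.
elim: n f => // n IHn f; rewrite ltnS => ltn f0.
pose A := [set i | f i != 0].
(* On a clique support Cauchy-Schwarz suffices: irreflexivity puts the diagonal terms [f i ^+ 2]
   among the non-adjacent pairs. *)
have [cA|ncA] := boolP (clique e A).
  have -> : \sum_i f i = \sum_(i in A) f i.
    rewrite [RHS]big_mkcond /=; apply: eq_bigr => i _; rewrite inE.
    by case: eqP => //= ->.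
  apply: le_trans (sqr_sum_le_card _ _) _.
  apply: ler_pM => //; first by apply: sumr_ge0 => i _; exact: sqr_ge0.
    by rewrite ler_nat card_clique_le.
  rewrite big_mkcond /=; apply: ler_sum => i _.
  rewrite (bigD1 i) /=; last by rewrite irre.
  have rest0 : 0 <= \sum_(j | ~~ e i j && (j != i)) f i * f j.
    by apply: sumr_ge0 => j _; rewrite mulr_ge0.
  by rewrite -expr2; case: ifP => _; [rewrite lerDl | rewrite addr_ge0 ?sqr_ge0].
have [i [j [ai aj neij nij]]] : exists i, exists j,
    [/\ f i != 0, f j != 0, i != j & ~~ e i j].
  move: ncA => /forall_inPn[i ai /forall_inPn[j aj]].
  rewrite negb_imply => /andP[neij nij].
  by move: ai aj; rewrite !inE => ai aj; exists i, j.
pose B k := \sum_l N k l * f l.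
(* [B] is half the gradient of the quadratic form, so weight moves to the endpoint where it is
   smaller. *)
wlog leB : i j ai aj neij nij / B i <= B j.
  move=> wl; have [|/ltW] := leP (B i) (B j); first exact: wl.
  by apply: wl; rewrite // 1?eq_sym // syme.
pose d k : R := (k == i)%:R - (k == j)%:R.
pose g k := f k + f j * d k.
have gj : g j = 0.
  by rewrite /g /d eqxx eq_sym (negbTE neij) /=; ring.
have gi : g i = f i + f j.
  by rewrite /g /d eqxx (negbTE neij) /=; ring.
have gk k : k != i -> k != j -> g k = f k.
  by move=> /negbTE ki /negbTE kj; rewrite /g /d ki kj /=; ring.
have g0 k : 0 <= g k.
  have [->|kj] := eqVneq k j; first by rewrite gj.
  have [->|ki] := eqVneq k i; first by rewrite gi addr_ge0.
  by rewrite gk.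
have supp_g : (#|[set k | g k != 0%R]| < n)%N.
  apply: leq_trans ltn; apply/proper_card/properP; split.
    apply/fintype.subsetP=> k; rewrite !inE.
    have [->|kj] := eqVneq k j; first by rewrite gj eqxx.
    by have [->|ki] := eqVneq k i; rewrite // gk.
  by exists j; rewrite !inE // gj eqxx.
have sum_d (h : T -> R) : \sum_k h k * d k = h i - h j.
  under eq_bigr => k _ do rewrite mulrBr.
  rewrite sumrB; congr (_ - _).
    by rewrite (bigD1 i) //= eqxx mulr1 big1 ?addr0 // => k /negbTE->; rewrite mulr0.
  by rewrite (bigD1 j) //= eqxx mulr1 big1 ?addr0 // => k /negbTE->; rewrite mulr0.
have sum_g : \sum_k g k = \sum_k f k.
  rewrite /g big_split /= (sum_d (fun=> f j)); ring.
have Nsym k l : N k l = N l k by rewrite /N syme.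
have Bg : \sum_k \sum_l N k l * (g k * g l)
    = \sum_k \sum_l N k l * (f k * f l) + f j * (B i - B j) *+ 2.
  (* The second-order term vanishes: [N] is 1 on the diagonal and on the pair [i], [j], and the
     signs cancel. *)
  have dd : \sum_k \sum_l N k l * (d k * d l) = 0.
    under eq_bigr => k _ do (under eq_bigr => l _ do rewrite mulrA; rewrite sum_d).
    under eq_bigr => k _ do rewrite -mulrBl.
    by rewrite sum_d /N !irre nij syme nij /=; ring.
  have df : \sum_k \sum_l N k l * (d k * f l) = B i - B j.
    rewrite -sum_d; apply: eq_bigr => k _; rewrite /B mulr_suml.
    by apply: eq_bigr => l _; ring.
  have fd : \sum_k \sum_l N k l * (f k * d l) = B i - B j.
    rewrite exchange_big -df; apply: eq_bigr => k _; apply: eq_bigr => l _.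
    by rewrite Nsym; ring.
  have -> : \sum_k \sum_l N k l * (g k * g l) =
      \sum_k \sum_l N k l * (f k * f l)
      + f j * (\sum_k \sum_l N k l * (d k * f l))
      + f j * (\sum_k \sum_l N k l * (f k * d l))
      + f j ^+ 2 * (\sum_k \sum_l N k l * (d k * d l)).
    rewrite !mulr_sumr -!big_split /=; apply: eq_bigr => k _.
    rewrite !mulr_sumr -!big_split /=; apply: eq_bigr => l _.
    by rewrite /g; ring.
  by rewrite dd df fd; ring.
have := IHn g supp_g g0; rewrite sum_g !NE Bg => /le_trans; apply.
apply: ler_wpM2l; first exact: ler0n.
by rewrite gerDl mulrn_wle0 // mulr_ge0_le0 // subr_le0.
Qed.

(** * Planar vectors *)

Lemma sum_sqr_dot (R : realFieldType) (T : finType) (p q : T -> R) :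
  \sum_i \sum_j (p i * p j + q i * q j) ^+ 2
  = (\sum_i p i ^+ 2) ^+ 2 + 2 * (\sum_i p i * q i) ^+ 2
    + (\sum_i q i ^+ 2) ^+ 2.
Proof.
rewrite !expr2 !mulr_suml mulr_sumr -!big_split /=; apply: eq_bigr => i _.
rewrite !mulr_sumr -!big_split /=; apply: eq_bigr => j _; ring.
Qed.

(* The squared Gram matrix of nonnegative vectors is completely positive. *)
Lemma nonneg_gram_nonadjacent (R : rcfType) (T : finType) (e : rel T)
    (p q : T -> R) :
    simple_graph e -> (forall i, 0 <= p i) -> (forall i, 0 <= q i) ->
  \sum_i \sum_j (p i * p j + q i * q j) ^+ 2
    <= (clique_number e)%:R
       * \sum_i \sum_(j | ~~ e i j) (p i * p j + q i * q j) ^+ 2.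
Proof.
move=> gG p0 q0; rewrite sum_sqr_dot.
have p2 i : 0 <= p i ^+ 2 by exact: sqr_ge0.
have q2 i : 0 <= q i ^+ 2 by exact: sqr_ge0.
have pq i : 0 <= p i * q i by exact: mulr_ge0.
have := motzkin_straus gG p2; have := motzkin_straus gG pq.
have := motzkin_straus gG q2.
have -> : \sum_i \sum_(j | ~~ e i j) (p i * p j + q i * q j) ^+ 2 =
   \sum_i \sum_(j | ~~ e i j) p i ^+ 2 * p j ^+ 2
   + 2 * (\sum_i \sum_(j | ~~ e i j) (p i * q i) * (p j * q j))
   + \sum_i \sum_(j | ~~ e i j) q i ^+ 2 * q j ^+ 2.
  rewrite mulr_sumr -!big_split /=; apply: eq_bigr => i _.
  by rewrite mulr_sumr -!big_split /=; apply: eq_bigr => j _; ring.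
lra.
Qed.

(** Split the points by the sign of [q]; each half, reflected if necessary, lies in a quadrant. One
    factor 2 comes from adding the halves, the other from comparing the squared trace of a 2 by 2
    Gram matrix with its squared Frobenius norm. *)
Lemma halfplane_nonadjacent (R : rcfType) (T : finType) (e : rel T)
    (p q : T -> R) :
    simple_graph e -> (forall i, 0 <= p i) ->
  (\sum_i (p i ^+ 2 + q i ^+ 2)) ^+ 2
    <= 4 * ((clique_number e)%:R
       * \sum_i \sum_(j | ~~ e i j) (p i * p j + q i * q j) ^+ 2).
Proof.
move=> gG p0.
pose p1 i := if 0 <= q i then p i else 0.
pose q1 i := if 0 <= q i then q i else 0.
pose p2 i := if 0 <= q i then 0 else p i.
pose q2 i := if 0 <= q i then 0 else - q i.
have p1_ge0 i : 0 <= p1 i by rewrite /p1; case: ifP.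
have p2_ge0 i : 0 <= p2 i by rewrite /p2; case: ifP.
have q1_ge0 i : 0 <= q1 i by rewrite /q1; case: ifP.
have q2_ge0 i : 0 <= q2 i by rewrite /q2; case: (leP 0 (q i)) => // /ltW; rewrite oppr_ge0.
have h1 := nonneg_gram_nonadjacent gG p1_ge0 q1_ge0.
have h2 := nonneg_gram_nonadjacent gG p2_ge0 q2_ge0.
have half (f g : T -> R) : (\sum_i (f i ^+ 2 + g i ^+ 2)) ^+ 2
    <= 2 * \sum_i \sum_j (f i * f j + g i * g j) ^+ 2.
  rewrite sum_sqr_dot big_split /=.
  set a := \sum_i f i ^+ 2; set b := \sum_i g i ^+ 2.
  by have := sqr_ge0 (\sum_i f i * g i); have := sqr_ge0 (a - b); lra.
have leN : \sum_i \sum_(j | ~~ e i j) (p1 i * p1 j + q1 i * q1 j) ^+ 2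
    + \sum_i \sum_(j | ~~ e i j) (p2 i * p2 j + q2 i * q2 j) ^+ 2
    <= \sum_i \sum_(j | ~~ e i j) (p i * p j + q i * q j) ^+ 2.
  rewrite -big_split; apply: ler_sum => i _ /=.
  rewrite -big_split; apply: ler_sum => j _ /=; rewrite /p1 /p2 /q1 /q2.
  have := sqr_ge0 (p i * p j + q i * q j).
  by case: ifP => _; case: ifP => _ ?; lra.
have -> : \sum_i (p i ^+ 2 + q i ^+ 2) =
    \sum_i (p1 i ^+ 2 + q1 i ^+ 2) + \sum_i (p2 i ^+ 2 + q2 i ^+ 2).
  rewrite -big_split /=; apply: eq_bigr => i _; rewrite /p1 /p2 /q1 /q2.
  by case: ifP => _; ring.
have k1 := half p1 q1; have k2 := half p2 q2.
have := sqr_ge0 (\sum_i (p1 i ^+ 2 + q1 i ^+ 2) - \sum_i (p2 i ^+ 2 + q2 i ^+ 2)).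
have := ler_wpM2l (ler0n R (clique_number e)) leN; rewrite mulrDr.
lra.
Qed.

(** Take [a] with least [h a] among the points whose lower set carries the fraction [eps] of the
    weight. If the points strictly below [a] carried more, the highest of them would be a smaller
    candidate. *)
Lemma weighted_quantile (R : realFieldType) (T : finType) (h w : T -> R)
    (eps : R) :
    (0 < #|T|)%N -> (forall i, 0 <= w i) -> 0 <= eps <= 1 ->
  exists a, \sum_(j | h j < h a) w j <= eps * \sum_j w j
    /\ eps * \sum_j w j <= \sum_(j | h j <= h a) w j.
Proof.
move=> /card_gt0P[x0 _] w0 /andP[e0 e1].
have W0 : 0 <= \sum_j w j by apply: sumr_ge0.
pose Q a := eps * \sum_j w j <= \sum_(j | h j <= h a) w j.
case: (@arg_maxP _ _ _ x0 xpredT h) => // m _ maxm.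
have Qm : Q m.
  have allm : \sum_(j | h j <= h m) w j = \sum_j w j.
    by apply: eq_bigl => j; exact: maxm.
  by rewrite /Q allm ler_piMl.
case: (@arg_minP _ _ _ m Q h Qm) => a Qa mina.
exists a; split=> //; rewrite leNgt; apply/negP => lt.
have [k0 k0a] : exists k, h k < h a.
  apply/existsP; apply: contraTT lt; rewrite negb_exists => /forallP no.
  by rewrite -leNgt big_pred0 ?mulr_ge0 // => j; apply/negbTE/no.
case: (@arg_maxP _ _ _ k0 (fun k => h k < h a) h k0a) => k ka maxk.
have : h a <= h k.
  apply: mina; apply: le_trans (ltW lt) _.
  rewrite [leLHS]big_mkcond [leRHS]big_mkcond /=; apply: ler_sum => j _.
  by case: ifP => [/maxk /= ->|_]; last case: ifP.
by rewrite leNgt ka.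
Qed.

(* Rounding of unit vectors [(x, y)] with [y >= 0] and [x >= - tau y] to the
   positive quadrant: inner products do not increase where they are
   nonnegative. *)
Section Rounding.
Variables (R : realFieldType) (tau : R).

Definition round1 (x : R) := Num.max x 0.
(** Lowering [y] by [tau] times a positive [x] pays for the negative first coordinate of a partner
    vector. *)
Definition round2 (x y : R) := Num.max (y - tau * Num.max x 0) 0.

Let good (X Y : R) :=
  (Y <= X \/ Y = 0) /\ (- (2 * tau) <= X - Y <= 2 * tau).

Let round_mixed (x y x' y' : R) : x <= 0 -> 0 <= x' <= 1 -> 0 <= y <= 1 ->
    0 <= y' <= 1 -> 0 <= tau <= 1 -> - (tau * y) <= x ->
  good (x * x' + y * y') (y * Num.max (y' - tau * x') 0).
Proof.
move=> x0 /andP[x0' x1'] /andP[y0 y1] /andP[y0' y1'] /andP[t0 t1] xt.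
have ty : tau * y <= tau by rewrite ler_piMr.
have tx : 0 <= tau * x' <= tau by rewrite mulr_ge0 // ler_piMr.
have xx : - tau <= x * x' <= 0 by apply/andP; split; nra.
have xy : - (tau * y * x') <= x * x' by rewrite -mulNr ler_wpM2r.
case: (leP (y' - tau * x') 0) => z.
  have yy : 0 <= y * y' <= tau by apply/andP; split; nra.
  by rewrite /good mulr0; split; [right | apply/andP; split; lra].
split; first by left; lra.
have yt : 0 <= y * (tau * x') <= tau by apply/andP; split; nra.
by rewrite mulrBr; apply/andP; split; lra.
Qed.

(** Only when [x] and [x'] have opposite signs can [X] be negative, and then [Y] is 0. For the
    second bound, [X - Y] and [X + Y] are at most [2 * tau] and 2 in absolute value. *)
Lemma round_dot (x y x' y' : R) :
    x ^+ 2 + y ^+ 2 = 1 -> x' ^+ 2 + y' ^+ 2 = 1 -> 0 <= y -> 0 <= y' ->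
    0 <= tau <= 1 -> - (tau * y) <= x -> - (tau * y') <= x' ->
  let Y := round1 x * round1 x' + round2 x y * round2 x' y' in
  let X := x * x' + y * y' in
  Y ^+ 2 <= X ^+ 2 /\ X ^+ 2 <= Y ^+ 2 + 4 * tau.
Proof.
move=> u1 u1' y0 y0' /andP[t0 t1] xt xt' Y X.
have le1 (a b : R) : a ^+ 2 + b ^+ 2 = 1 -> a <= 1.
  by move=> ab1; have := sqr_ge0 (a - 1); have := sqr_ge0 b; lra.
have y1 : y <= 1 by apply: (le1 _ x); rewrite addrC.
have y1' : y' <= 1 by apply: (le1 _ x'); rewrite addrC.
have x1 := le1 _ _ u1; have x1' := le1 _ _ u1'.
have X1 : -1 <= X <= 1.
  have := sqr_ge0 (x - x'); have := sqr_ge0 (y - y').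
  have := sqr_ge0 (x + x'); have := sqr_ge0 (y + y').
  by rewrite /X => *; apply/andP; split; lra.
have Y0 : 0 <= Y.
  by rewrite /Y /round1 /round2 addr_ge0 // mulr_ge0 // le_max lexx orbT.
have ry : Num.max y 0 = y by exact/max_idPl.
have ry' : Num.max y' 0 = y' by exact/max_idPl.
have [h1 /andP[h2 h3]] : good X Y.
  rewrite /Y /X /round1 /round2.
  case: (leP x 0) => xs; case: (leP x' 0) => xs';
    rewrite ?mulr0 ?mul0r ?add0r ?subr0 ?ry ?ry'.
  - have xx : 0 <= x * x' <= tau.
      have : (- x) * (- x') <= tau * tau by apply: ler_pM; nra.
      by move=> ?; apply/andP; split; nra.
    by split; [left | apply/andP; split]; lra.
  - by apply: round_mixed; rewrite ?y0 ?y0' ?t0 ?(ltW xs') //.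
  - rewrite [x * x']mulrC [y * y']mulrC [_ * y']mulrC.
    by apply: round_mixed; rewrite ?y0 ?y0' ?t0 ?(ltW xs).
  - have tx : 0 <= tau * x <= tau by apply/andP; split; nra.
    have tx' : 0 <= tau * x' <= tau by apply/andP; split; nra.
    set z := Num.max _ 0; set z' := Num.max _ 0.
    have /andP[z0 zy] : 0 <= z <= y by rewrite /z le_max lexx orbT ge_max y0 andbT /=; lra.
    have zt : y - tau <= z by rewrite /z le_max; apply/orP; left; lra.
    have /andP[z0' zy'] : 0 <= z' <= y' by rewrite /z' le_max lexx orbT ge_max y0' andbT /=; lra.
    have zt' : y' - tau <= z' by rewrite /z' le_max; apply/orP; left; lra.
    have /andP[l0 l1] : 0 <= y * (y' - z') <= tau by apply/andP; split; nra.
    have /andP[k0 k1] : 0 <= (y - z) * z' <= tau by apply/andP; split; nra.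
    by split; [left | apply/andP; split]; lra.
have Y1 : Y <= 1 by case: h1 => [|->]; lra.
split.
  by case: h1 => [|->]; [move=> ?; rewrite ler_sqr ?nnegrE //; lra | rewrite expr0n sqr_ge0].
have -> : X ^+ 2 = Y ^+ 2 + (X - Y) * (X + Y) by ring.
rewrite lerD2l; nra.
Qed.
End Rounding.

(** * Angular sectors in polar coordinates *)

Section Polar.
Variables (R : realType) (T : finType) (e : rel T) (r t : T -> R).
Hypotheses (gG : simple_graph e) (r0 : forall i, 0 <= r i).
Hypothesis tpi : forall i, - (pi / 2) <= t i <= pi / 2.

Let W := \sum_i r i ^+ 2.
Let X i j := r i * r j * cos (t i - t j).

(** Points outside the sector from [t a] to [t b] are discarded; the others are measured from the
    ray [t a] and rounded into a quadrant, where the Gram bound applies. Rounding costs [4 * tau];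
    discarding costs [eps] for each end and each index of a pair. *)
Lemma cone_nonadjacent (a b : T) (sigma eps : R) :
    0 <= sigma <= 1 / 2 -> (t a <= t b -> - sigma <= cos (t b - t a)) ->
    \sum_(j | t j < t a) r j ^+ 2 <= eps * W ->
    \sum_(j | t b < t j) r j ^+ 2 <= eps * W ->
  \sum_i \sum_j X i j ^+ 2
    <= (clique_number e)%:R * \sum_i \sum_(j | ~~ e i j) X i j ^+ 2
       + (8 * sigma + 4 * eps) * W ^+ 2.
Proof.
move=> /andP[s0 s1] ab outa outb.
pose C i := t a <= t i <= t b.
(* A negative first coordinate is at least [- sigma], hence at least -1/2, so the second is at least
   1/2; this gives the slope [2 * sigma]. *)
pose tau := 2 * sigma.
pose x i := cos (t i - t a); pose y i := sin (t i - t a).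
have unit i : x i ^+ 2 + y i ^+ 2 = 1 by exact: cos2Dsin2.
have diff_pi i j : t i <= t j -> 0 <= t j - t i <= pi.
  by have /andP[i1 i2] := tpi i; have /andP[j1 j2] := tpi j => ?; lra.
have y0 i : C i -> 0 <= y i.
  by move=> /andP[ai _]; apply/sin_ge0_pi/diff_pi.
have xs i : C i -> - sigma <= x i.
  move=> /andP[ai ib]; have le_ab := le_trans ai ib.
  apply: le_trans (ab le_ab) _; rewrite leNgt ltr_cos ?in_itv /= ?diff_pi //.
  by rewrite -leNgt lerD2r.
have xt i : C i -> - (tau * y i) <= x i.
  move=> Ci; have yi := y0 i Ci; have xi := xs i Ci; have ui := unit i.
  have [xp|xn] := leP 0 (x i); first by rewrite (le_trans _ xp) // oppr_le0 mulr_ge0 // /tau; lra.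
  have x2 : x i ^+ 2 <= sigma ^+ 2.
    by rewrite -[x i ^+ 2]sqrrN ler_sqr ?nnegrE ?oppr_ge0 ?(ltW xn) //; lra.
  have y2 : 1 / 2 <= y i.
    rewrite -(@ler_sqr _ (1 / 2)) ?nnegrE ?divr_ge0 //.
    have : sigma ^+ 2 <= (1 / 2) ^+ 2 by rewrite ler_sqr ?nnegrE; lra.
    lra.
  by rewrite /tau; nra.
have t01 : 0 <= tau <= 1 by rewrite /tau; lra.
pose p i := if C i then r i * round1 (x i) else 0.
pose q i := if C i then r i * round2 tau (x i) (y i) else 0.
have p0 i : 0 <= p i.
  by rewrite /p; case: ifP => _ //; rewrite mulr_ge0 // /round1 le_max lexx orbT.
have q0 i : 0 <= q i.
  by rewrite /q; case: ifP => _ //; rewrite mulr_ge0 // /round2 le_max lexx orbT.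
have XE i j : X i j = r i * r j * (x i * x j + y i * y j).
  rewrite /x /y -cosB; congr (_ * cos _); ring.
pose Y i j := p i * p j + q i * q j.
have YE i j : C i -> C j -> Y i j = r i * r j *
    (round1 (x i) * round1 (x j) + round2 tau (x i) (y i) * round2 tau (x j) (y j)).
  by rewrite /Y /p /q => -> ->; ring.
have Y0 i j : ~~ (C i && C j) -> Y i j = 0.
  by rewrite /Y /p /q; do 2![case: (C _)] => //= _; ring.
have leYX i j : Y i j ^+ 2 <= X i j ^+ 2.
  have [/andP[Ci Cj]|/Y0->] := boolP (C i && C j); last by rewrite expr0n sqr_ge0.
  rewrite YE // XE !exprMn ler_wpM2l ?mulr_ge0 ?sqr_ge0 //.
  by case: (round_dot (unit i) (unit j) (y0 i Ci) (y0 j Cj) t01 (xt i Ci) (xt j Cj)).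
pose out i : R := (~~ C i)%:R.
have leXY i j : X i j ^+ 2 <= Y i j ^+ 2 + 4 * tau * (r i ^+ 2 * r j ^+ 2)
    + out i * (r i ^+ 2 * r j ^+ 2) + out j * (r i ^+ 2 * r j ^+ 2).
  have rr : 0 <= r i ^+ 2 * r j ^+ 2 by rewrite mulr_ge0 ?sqr_ge0.
  have outrr k : 0 <= out k * (r i ^+ 2 * r j ^+ 2) by rewrite mulr_ge0 // ler0n.
  have tp : 0 <= 4 * tau * (r i ^+ 2 * r j ^+ 2) by rewrite mulr_ge0 // /tau; lra.
  have [/andP[Ci Cj]|nC] := boolP (C i && C j).
    rewrite -addrA -[leLHS]addr0 lerD ?addr_ge0 //.
    rewrite YE // XE !exprMn [4 * tau * _]mulrC -mulrDr ler_wpM2l //.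
    by case: (round_dot (unit i) (unit j) (y0 i Ci) (y0 j Cj) t01 (xt i Ci) (xt j Cj)).
  have X1 : X i j ^+ 2 <= r i ^+ 2 * r j ^+ 2.
    rewrite /X !exprMn ler_piMr // -(cos2Dsin2 (t i - t j)) lerDl sqr_ge0 //.
  have Y2 := sqr_ge0 (Y i j).
  have := outrr i; have := outrr j; move: nC; rewrite /out.
  by case: (C i); case: (C j) => //= _; rewrite ?mul1r ?mul0r; lra.
have outW : \sum_i out i * r i ^+ 2 <= 2 * eps * W.
  have -> : 2 * eps * W = eps * W + eps * W by ring.
  apply: le_trans (lerD outa outb).
  rewrite (big_mkcond (fun j => t j < t a)) (big_mkcond (fun j => t b < t j)) /=.
  rewrite -big_split; apply: ler_sum => i _ /=; rewrite /out /C.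
  have := sqr_ge0 (r i).
  by case: (leP (t a) (t i)); case: (leP (t i) (t b)) => /= *; lra.
have key : \sum_i \sum_j X i j ^+ 2 <= \sum_i \sum_j Y i j ^+ 2
    + 4 * tau * W ^+ 2 + 2 * ((\sum_i out i * r i ^+ 2) * W).
  have -> : 4 * tau * W ^+ 2 = \sum_i \sum_j 4 * tau * (r i ^+ 2 * r j ^+ 2).
    rewrite expr2 mulr_suml mulr_sumr; apply: eq_bigr => i _.
    by rewrite -mulr_sumr -mulr_sumr.
  have eL : (\sum_i out i * r i ^+ 2) * W = \sum_i \sum_j out i * (r i ^+ 2 * r j ^+ 2).
    by rewrite mulr_suml; apply: eq_bigr => i _; rewrite mulr_sumr; apply: eq_bigr => j _; ring.
  have eR : (\sum_i out i * r i ^+ 2) * W = \sum_i \sum_j out j * (r i ^+ 2 * r j ^+ 2).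
    rewrite eL exchange_big; apply: eq_bigr => i _; apply: eq_bigr => j _; ring.
  rewrite (_ : 2 * _ = \sum_i \sum_j out i * (r i ^+ 2 * r j ^+ 2)
      + \sum_i \sum_j out j * (r i ^+ 2 * r j ^+ 2)); last by rewrite -eL -eR; ring.
  rewrite addrA -!big_split; apply: ler_sum => i _ /=.
  by rewrite -!big_split; apply: ler_sum => j _ /=.
apply: le_trans key _.
have W0 : 0 <= W by apply: sumr_ge0 => i _; exact: sqr_ge0.
have oW : (\sum_i out i * r i ^+ 2) * W <= 2 * eps * W * W by rewrite ler_wpM2r.
have hY := nonneg_gram_nonadjacent gG p0 q0.
have hN : (clique_number e)%:R * \sum_i \sum_(j | ~~ e i j) Y i j ^+ 2
   <= (clique_number e)%:R * \sum_i \sum_(j | ~~ e i j) X i j ^+ 2.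
  by rewrite ler_wpM2l ?ler0n //; apply: ler_sum => i _; apply: ler_sum.
have -> : (8 * sigma + 4 * eps) * W ^+ 2 = 4 * tau * W ^+ 2 + 2 * (2 * eps * W * W).
  by rewrite /tau; ring.
by have := le_trans hY hN; lra.
Qed.

(** A point at or below [t a] and one at or above [t b] differ by an angle between [t b - t a] and
    [pi], so their entry is at most [- sigma] times the product of the radii. The squares over these
    pairs sum to at least [sigma ^+ 2] times the product of the end weights. *)
Lemma obtuse_quantiles (a b : T) (sigma eps : R) :
    0 <= sigma -> 0 <= eps -> t a <= t b -> cos (t b - t a) <= - sigma ->
    eps * W <= \sum_(j | t j <= t a) r j ^+ 2 ->
    eps * W <= \sum_(j | t b <= t j) r j ^+ 2 ->
  (sigma * eps * W) ^+ 2 <= \sum_i \sum_j (Num.min (X i j) 0) ^+ 2.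
Proof.
move=> s0 e0 ab obt qa qb.
have W0 : 0 <= W by apply: sumr_ge0 => i _; exact: sqr_ge0.
have eW : 0 <= eps * W by rewrite mulr_ge0.
have -> : (sigma * eps * W) ^+ 2 = sigma ^+ 2 * ((eps * W) * (eps * W)) by ring.
apply: le_trans (_ : sigma ^+ 2 * ((\sum_(j | t j <= t a) r j ^+ 2)
    * (\sum_(j | t b <= t j) r j ^+ 2)) <= _).
  by rewrite ler_wpM2l ?sqr_ge0 // ler_pM.
rewrite mulr_suml mulr_sumr big_mkcond; apply: ler_sum => i _ /=.
case: ifP => ia; last by apply: sumr_ge0 => j _; exact: sqr_ge0.
rewrite !mulr_sumr big_mkcond; apply: ler_sum => j _ /=.
case: ifP => bj; last exact: sqr_ge0.
have cosij : cos (t i - t j) <= - sigma.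
  apply: le_trans obt; rewrite -cosN opprB leNgt ltr_cos ?in_itv /=.
  - by rewrite -leNgt; lra.
  - by have /andP[? ?] := tpi i; have /andP[? ?] := tpi j; lra.
  - by have /andP[? ?] := tpi a; have /andP[? ?] := tpi b; lra.
have rr : 0 <= r i * r j by rewrite mulr_ge0.
have Xs : X i j <= - (sigma * (r i * r j)).
  by rewrite /X -mulNr mulrC ler_wpM2r.
have srr : 0 <= sigma * (r i * r j) by rewrite mulr_ge0.
have -> : sigma ^+ 2 * (r i ^+ 2 * r j ^+ 2) = (sigma * (r i * r j)) ^+ 2 by ring.
rewrite -[leRHS]sqrrN ler_sqr ?nnegrE // ?oppr_ge0 ?ge_min ?lexx ?orbT //.
by rewrite lerNr ge_min Xs.
Qed.

End Polar.

Lemma polar_halfplane (R : realType) (x y : R) : 0 <= x ->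
  let r := Num.sqrt (x ^+ 2 + y ^+ 2) in
  let t := asin (y / r) in
  [/\ - (pi / 2) <= t <= pi / 2, x = r * cos t & y = r * sin t].
Proof.
move=> x0 r t.
have s0 : 0 <= x ^+ 2 + y ^+ 2 by rewrite addr_ge0 ?sqr_ge0.
have r2 : r ^+ 2 = x ^+ 2 + y ^+ 2 by rewrite sqr_sqrtr.
have r_ge0 : 0 <= r by exact: sqrtr_ge0.
(* At the origin [y / r] is 0 because the inverse of 0 is 0, so the angle is [asin 0]. *)
have [re|rn] := eqVneq r 0.
  have /andP[/eqP x00 /eqP y00] : (x == 0) && (y == 0).
    rewrite -(sqrf_eq0 x) -(sqrf_eq0 y) -paddr_eq0 ?sqr_ge0 //.
    by rewrite -r2 re expr0n.
  rewrite /t re x00 y00 invr0 mulr0 !mul0r; split=> //.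
  by rewrite asin_geNpi2 ?asin_lepi2 //; lra.
have rp : 0 < r by rewrite lt_neqAle eq_sym rn.
have yr2 : (y / r) ^+ 2 = 1 - (x / r) ^+ 2.
  by rewrite !exprMn !exprVn r2; field; rewrite -r2 expf_neq0.
have yr : -1 <= y / r <= 1.
  by rewrite -ler_norml -(@expr_le1 _ 2%N) // real_normK ?num_real // yr2 gerBl sqr_ge0.
split; first by rewrite asin_geNpi2 ?asin_lepi2.
  by rewrite cos_asin // yr2 subKr sqrtr_sqr ger0_norm ?divr_ge0 // mulrC divfK.
by rewrite asinK ?in_itv // mulrC divfK.
Qed.

(** * Squared mass of the positive adjacent entries *)

Lemma powR56 (R : realType) (x : R) : 1 <= x ->
  exists2 h : R, 0 < h & h ^+ 6 * x = 1 /\ x `^ (5 / 6) = x * h.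
Proof.
move=> x1; have x0 : 0 < x by lra.
exists (x `^ (- (1 / 6))); first exact: powR_gt0.
have xD y z : x `^ (y + z) = x `^ y * x `^ z.
  by rewrite powRD // (gt_eqF x0) implybT.
split.
  rewrite -powR_mulrn ?powR_ge0 // -powRrM -[X in _ * X]powRr1 ?(ltW x0) // -xD.
  by rewrite (_ : _ + _ = 0) ?powRr0 //; field.
have -> : 5 / 6 = 1 + - (1 / 6) :> R by field.
by rewrite xD powRr1 // ltW.
Qed.

Lemma positive_edge_mass (R : realType) (T : finType) (e : rel T)
    (p q : T -> R) :
    let X i j := p i * p j + q i * q j in
    let S := \sum_i \sum_j X i j ^+ 2 in
    let omega : R := (clique_number e)%:R in
    (0 < #|T|)%N -> simple_graph e -> (forall i, 0 <= p i) ->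
    (\sum_i (p i ^+ 2 + q i ^+ 2)) ^+ 2 <= 2 * S ->
  \sum_i \sum_(j | e i j) Num.max (X i j) 0 ^+ 2
    <= (1 - 1 / (omega + 50 * omega `^ (5 / 6))) * S.
Proof.
move=> X S omega T0 gG p0.
pose r i := Num.sqrt (p i ^+ 2 + q i ^+ 2); pose t i := asin (q i / r i).
have r2 i : r i ^+ 2 = p i ^+ 2 + q i ^+ 2 by rewrite sqr_sqrtr // addr_ge0 ?sqr_ge0.
have r0 i : 0 <= r i by exact: sqrtr_ge0.
have tpi i : - (pi / 2) <= t i <= pi / 2 by case: (polar_halfplane (q i) (p0 i)).
have pE i : p i = r i * cos (t i) by case: (polar_halfplane (q i) (p0 i)).
have qE i : q i = r i * sin (t i) by case: (polar_halfplane (q i) (p0 i)).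
have XE i j : X i j = r i * r j * cos (t i - t j).
  by rewrite cosB /X (pE i) (pE j) (qE i) (qE j); ring.
pose W := \sum_i r i ^+ 2.
have -> : \sum_i (p i ^+ 2 + q i ^+ 2) = W by apply: eq_bigr => i _; rewrite r2.
move=> W2S.
have W0 : 0 <= W by apply: sumr_ge0 => i _; exact: sqr_ge0.
have SW : S <= W ^+ 2.
  rewrite expr2 mulr_suml; apply: ler_sum => i _.
  rewrite mulr_sumr; apply: ler_sum => j _.
  by rewrite XE !exprMn ler_piMr ?mulr_ge0 ?sqr_ge0 // -(cos2Dsin2 (t i - t j)) lerDl sqr_ge0.
have S0 : 0 <= S by apply: sumr_ge0 => i _; apply: sumr_ge0 => j _; exact: sqr_ge0.
set M := \sum_i \sum_(j | e i j) _.
pose N := \sum_i \sum_(j | ~~ e i j) X i j ^+ 2.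
pose G := \sum_i \sum_j Num.min (X i j) 0 ^+ 2.
(* [M] omits non-adjacent pairs and negative entries, so [N] and [G] are each a lower bound for
   [S - M]. *)
have MNS : M + N <= S.
  rewrite /M /N /S -big_split; apply: ler_sum => i _ /=.
  rewrite [X in X + _]big_mkcond [X in _ + X]big_mkcond /= -big_split.
  apply: ler_sum => j _ /=; case: (e i j) => /=; rewrite ?addr0 ?add0r //.
  by case: (leP (X i j) 0) => _ //; rewrite expr0n sqr_ge0.
have MGS : M + G <= S.
  rewrite /M /G /S -big_split; apply: ler_sum => i _ /=.
  rewrite [X in X + _]big_mkcond /= -big_split; apply: ler_sum => j _ /=.
  have X0 := sqr_ge0 (X i j).
  by case: (e i j) => /=; case: (leP (X i j) 0) => _; rewrite ?expr0n /=; lra.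
have om1 : 1 <= omega by rewrite /omega ler1n clique_number_gt0.
have [h h0 [h6 ->]] := powR56 om1.
have K0 : 0 < 1 + 50 * h by lra.
have k0 : 0 < omega * (1 + 50 * h) by rewrite mulr_gt0 //; lra.
suff main : S <= omega * (1 + 50 * h) * (S - M).
  have -> : omega + 50 * (omega * h) = omega * (1 + 50 * h) by ring.
  have : S / (omega * (1 + 50 * h)) <= S - M by rewrite ler_pdivrMr // mulrC.
  by rewrite mulrBl !mul1r [_^-1 * S]mulrC; lra.
have S_M : 0 <= S - M.
  have : 0 <= N by apply: sumr_ge0 => i _; apply: sumr_ge0 => j _; exact: sqr_ge0.
  lra.
have N_S_M : omega * N <= omega * (S - M) by rewrite ler_wpM2l; lra.
(* At [h = 3 / 50] the factor [1 + 50 * h] equals 4, the loss in [halfplane_nonadjacent]. *)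
have [h_large|h_small] := leP (3 / 50) h.
  have hN : W ^+ 2 <= 4 * (omega * N).
    have := halfplane_nonadjacent q gG p0.
    have -> // : \sum_i (p i ^+ 2 + q i ^+ 2) = W.
    by apply: eq_bigr => i _; rewrite r2.
  have : 4 * (omega * (S - M)) <= (1 + 50 * h) * (omega * (S - M)).
    by rewrite ler_wpM2r ?mulr_ge0 //; lra.
  lra.
have w0 i : 0 <= r i ^+ 2 by exact: sqr_ge0.
have h01 : 0 <= h <= 1 by lra.
have [a [outa qa]] := weighted_quantile t T0 w0 h01.
have [b [outb qb]] := weighted_quantile (fun i => - t i) T0 w0 h01.
have {}outb : \sum_(j | t b < t j) r j ^+ 2 <= h * W.
  by rewrite (eq_bigl (fun j => - t j < - t b)) // => j; rewrite ltrN2.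
have {}qb : h * W <= \sum_(j | t b <= t j) r j ^+ 2.
  by rewrite (eq_bigl (fun j => - t j <= - t b)) // => j; rewrite lerN2.
(* End weight [h] and sine [h ^+ 2] give negative mass at least [h ^+ 6 * W ^+ 2] in the obtuse
   case, and [h ^+ 6] is the inverse of [omega]; hence the sixth root. *)
have [/andP[ab obt]|acute] := boolP ((t a <= t b) && (cos (t b - t a) <= - h ^+ 2)).
  have hG : (h ^+ 2 * h * W) ^+ 2 <= G.
    have := obtuse_quantiles r0 tpi (sqr_ge0 h) (ltW h0) ab obt qa qb.
    rewrite (_ : \sum_i \sum_j Num.min (r i * r j * cos (t i - t j)) 0 ^+ 2 = G) //.
    by apply: eq_bigr => i _; apply: eq_bigr => j _; rewrite XE.
  have e6 : (h ^+ 2 * h * W) ^+ 2 = h ^+ 6 * W ^+ 2 by ring.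
  have : omega * (h ^+ 6 * S) <= omega * (S - M).
    rewrite ler_wpM2l; try lra.
    have : h ^+ 6 * S <= h ^+ 6 * W ^+ 2 by rewrite ler_wpM2l // exprn_ge0 // ltW.
    lra.
  rewrite mulrA [omega * _]mulrC h6 mul1r => /le_trans; apply.
  by rewrite mulrAC ler_peMr ?mulr_ge0 //; lra.
have hsmall2 : 0 <= h ^+ 2 <= 1 / 2.
  by rewrite sqr_ge0 /=; nra.
have cone_ab : t a <= t b -> - h ^+ 2 <= cos (t b - t a).
  by move=> ab; move: acute; rewrite ab /= -ltNge => /ltW.
have := cone_nonadjacent gG r0 tpi hsmall2 cone_ab outa outb.
rewrite -/W -/omega.
rewrite (_ : \sum_i \sum_j (r i * r j * cos (t i - t j)) ^+ 2 = S); last first.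
  by apply: eq_bigr => i _; apply: eq_bigr => j _; rewrite XE.
rewrite (_ : \sum_i \sum_(j | ~~ e i j) (r i * r j * cos (t i - t j)) ^+ 2 = N).
  move=> hS.
  have hS2 : S * (1 - 16 * h ^+ 2 - 8 * h) <= omega * (S - M).
    have : (8 * h ^+ 2 + 4 * h) * W ^+ 2 <= (8 * h ^+ 2 + 4 * h) * (2 * S).
      by rewrite ler_wpM2l //; nra.
    lra.
  (* The product expands to [1 + 42 * h - 416 * h ^+ 2 - 800 * h ^+ 3], which is at least 1 for
     [0 < h < 3 / 50]. *)
  have hh : 1 <= (1 - 16 * h ^+ 2 - 8 * h) * (1 + 50 * h).
    have h2 : h ^+ 2 <= 3 / 50 * h by nra.
    have h3 : h * h ^+ 2 <= (3 / 50) ^+ 2 * h by nra.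
    lra.
  rewrite mulrAC; apply: le_trans (_ : S * ((1 - 16 * h ^+ 2 - 8 * h) * (1 + 50 * h)) <= _).
    by rewrite ler_peMr.
  by rewrite mulrA ler_wpM2r // ltW.
by apply: eq_bigr => i _; apply: eq_bigr => j _; rewrite XE.
Qed.

(** * Eigenvectors of symmetric matrices *)

Section Symmetric.
Variables (R : rcfType) (n : nat).
Implicit Types (A : 'M[R]_n) (x y u : 'rV[R]_n) (s : seq R).
Local Open Scope sesquilinear_scope.

Lemma eigenvalue_list_le A s a :
  eigenvalue_list A s -> eigenvalue A a -> a <= s`_0.
Proof.
move=> [ss cA]; rewrite eigenvalue_root_char cA root_prod_XsubC.
case: s ss {cA} => //= b s; rewrite in_cons path_sortedE; last first.
  by move=> y x z xy yz; exact: le_trans yz xy.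
by move=> /andP[/allP sb _] /orP[/eqP->//|/sb].
Qed.

(** Diagonalise over the complex numbers by a unitary matrix: in the coordinates [c] the form is a
    sum of real eigenvalues times squared moduli, and each eigenvalue is at most the first entry of
    [s]. *)
Lemma rayleigh A s x : A^T = A -> eigenvalue_list A s ->
  (x *m A *m x^T) 0 0 <= s`_0 * (x *m x^T) 0 0.
Proof.
move=> symA ls; pose f := real_complex R; pose B := map_mx f A.
have herB : B \is hermsymmx.
  apply/is_hermitianmxP; rewrite expr0 scale1r.
  apply/matrixP=> i j; rewrite !mxE -[in LHS]symA mxE.
  by apply/esym/CrealP; rewrite complex_real.
have /orthomx_spectralP B_eq := hermitian_normalmx herB.
have /mxOverP dreal := hermitian_spectral_diag_real herB.
set P := spectralmx B in B_eq; set d := spectral_diag B in B_eq dreal.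
have uP : P \in unitmx by exact: spectral_unit.
have Pinv : invmx P = P^t* by exact/invmx_unitary/spectral_unitarymx.
have dE i : d 0 i = f (complex.Re (d 0 i)) by rewrite /f (RRe_real (dreal 0 i)).
have d_le i : complex.Re (d 0 i) <= s`_0.
  apply: (eigenvalue_list_le ls).
  suff : eigenvalue B (d 0 i).
    by rewrite dE !eigenvalue_root_char -map_char_poly fmorph_root.
  apply/eigenvalueP; exists (row i P).
    rewrite -row_mul {1}B_eq !mulmxA mulmxV // mul1mx row_mul row_diag_mx.
    by rewrite -scalemxAl -rowE.
  apply: contraTneq uP => Pi0; rewrite -row_free_unit -kermx_eq0.
  apply/negP => /eqP kP.
  have : (delta_mx 0 i : 'rV_n) *m P = 0 by rewrite -rowE.
  move/sub_kermxP; rewrite kP submx0 => /eqP/rowP/(_ i).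
  by rewrite !mxE !eqxx => /eqP; rewrite oner_eq0.
pose X := map_mx f x; pose c := X *m invmx P.
have XT : X^t* = X^T.
  apply/matrixP=> i j; rewrite !mxE; by apply/CrealP; rewrite complex_real.
have cT : c^t* = P *m X^T.
  by rewrite /c Pinv trmx_mul map_mxM /= trmxCK XT.
have eB : X *m B *m X^T = c *m diag_mx d *m c^t*.
  by rewrite cT B_eq /c !mulmxA.
have e1 : X *m X^T = c *m c^t*.
  by rewrite cT /c mulmxA mulmxKV.
have : (X *m B *m X^T) 0 0 <= f s`_0 * (X *m X^T) 0 0.
  rewrite eB e1 mul_mx_diag !mxE mulr_sumr; apply: ler_sum => i _.
  rewrite !mxE [_ * d 0 i]mulrC -mulrA ler_wpM2r ?mul_conjC_ge0 //.
  by rewrite dE lecR.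
by rewrite map_trmx -!map_mxM !mxE -rmorphM lecR.
Qed.

Lemma dot_ge0 x : 0 <= (x *m x^T) 0 0.
Proof. by rewrite mxE; apply: sumr_ge0 => i _; rewrite mxE -expr2 sqr_ge0. Qed.

Lemma dot_eq0 x : ((x *m x^T) 0 0 == 0) = (x == 0).
Proof.
apply/eqP/eqP => [|->]; last by rewrite mul0mx mxE.
rewrite mxE => /eqP; rewrite psumr_eq0 => [/allP x0|i _]; last first.
  by rewrite mxE -expr2 sqr_ge0.
apply/rowP=> i; have := x0 i (mem_index_enum i).
by rewrite !mxE -expr2 sqrf_eq0 => /eqP.
Qed.

(** Moving from [y] by [t] times [z := y *m B] changes the form by [2 * t * g + t ^+ 2 * b], with
    [g] the squared length of [z]; for positive [g] this is negative at small negative [t]. *)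
Lemma psd_isotropic (B : 'M[R]_n) y : B^T = B ->
    (forall x, 0 <= (x *m B *m x^T) 0 0) -> (y *m B *m y^T) 0 0 = 0 ->
  y *m B = 0.
Proof.
move=> symB psd By0; apply/eqP; rewrite -dot_eq0; apply/eqP.
set z := y *m B; set g := (z *m z^T) 0 0; set b := (z *m B *m z^T) 0 0.
have zB : z *m B *m y^T = z *m z^T by rewrite /z trmx_mul symB !mulmxA.
have yz : y *m B *m z^T = z *m z^T by [].
have D (M N : 'M[R]_1) : (M + N) 0 0 = M 0 0 + N 0 0 by rewrite mxE.
have Z t (M : 'M[R]_1) : (t *: M) 0 0 = t * M 0 0 by rewrite mxE.
have quad t : 0 <= 2 * t * g + t ^+ 2 * b.
  have := psd (y + t *: z).
  rewrite linearD linearZ /= !mulmxDl !mulmxDr -!scalemxAl -!scalemxAr.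
  rewrite zB yz !(D, Z) By0 -/g -/b => h; apply: le_trans h _.
  by rewrite le_eqVlt; apply/orP; left; apply/eqP; ring.
have g0 : 0 <= g by exact: dot_ge0.
have b0 : 0 <= b by exact: psd.
have [//|g_neq0] := eqVneq g 0.
have gp : 0 < g by rewrite lt_neqAle eq_sym g_neq0.
have b1 : 0 < b + 1 by lra.
(* The added 1 keeps the denominator positive when [b] is 0. *)
have := quad (- (g / (b + 1))).
have -> : 2 * - (g / (b + 1)) * g + (- (g / (b + 1))) ^+ 2 * b =
    - (g ^+ 2 * (b + 2) / (b + 1) ^+ 2) by field; rewrite gt_eqF.
rewrite oppr_ge0 leNgt divr_gt0 // ?exprn_gt0 // mulr_gt0 ?exprn_gt0 //; lra.
Qed.

Lemma size_eigenvalue_list A s : eigenvalue_list A s -> size s = n.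
Proof.
by move=> [_ cA]; have := size_char_poly A; rewrite cA size_prod_XsubC => -[].
Qed.

(** Taking absolute values in a top eigenvector keeps its length and does not lower the form of the
    nonnegative [A], so [y] attains the Rayleigh bound. It is then isotropic for the positive
    semidefinite [B], hence again an eigenvector. *)
Lemma perron A s : (0 < n)%N -> A^T = A -> (forall i j, 0 <= A i j) ->
    eigenvalue_list A s ->
  exists u, [/\ forall i, 0 <= u 0 i, (u *m u^T) 0 0 = 1 & u *m A = s`_0 *: u].
Proof.
move=> n0 symA A0 ls; have sz := size_eigenvalue_list ls.
have : eigenvalue A s`_0.
  by rewrite eigenvalue_root_char ls.2 root_prod_XsubC mem_nth // sz.
move=> /eigenvalueP[x xA xn0]; pose y := map_mx Num.norm x.
have yy : (y *m y^T) 0 0 = (x *m x^T) 0 0.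
  rewrite !mxE; apply: eq_bigr => i _; rewrite !mxE -!expr2.
  by rewrite real_normK ?num_real.
have yAy : s`_0 * (y *m y^T) 0 0 <= (y *m A *m y^T) 0 0.
  have -> : s`_0 * (y *m y^T) 0 0 = (x *m A *m x^T) 0 0.
    by rewrite yy xA -scalemxAl [RHS]mxE.
  rewrite !mxE; apply: ler_sum => i _; rewrite !mxE !mulr_suml.
  apply: ler_sum => j _; rewrite !mxE.
  apply: le_trans (ler_norm _) _.
  by rewrite !normrM (ger0_norm (A0 _ _)).
pose B := (s`_0)%:M - A.
have zBz (z : 'rV_n) : (z *m B *m z^T) 0 0 =
    s`_0 * (z *m z^T) 0 0 - (z *m A *m z^T) 0 0.
  by rewrite mulmxBr mulmxBl mul_mx_scalar -scalemxAl 2!mxE [X in _ + X]mxE.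
have psdB (z : 'rV_n) : 0 <= (z *m B *m z^T) 0 0 by rewrite zBz subr_ge0 rayleigh.
have symB : B^T = B by rewrite /B linearB /= tr_scalar_mx symA.
have yB : y *m B = 0.
  apply: psd_isotropic => //; apply/eqP; rewrite eq_le psdB andbT.
  by rewrite zBz subr_le0.
have yA : y *m A = s`_0 *: y.
  by move/eqP: yB; rewrite mulmxBr mul_mx_scalar subr_eq0 => /eqP.
have g0 : 0 < (y *m y^T) 0 0 by rewrite yy lt_neqAle eq_sym dot_eq0 xn0 dot_ge0.
set g := (y *m y^T) 0 0 in g0.
have sg0 : 0 < Num.sqrt g by rewrite sqrtr_gt0.
exists ((Num.sqrt g)^-1 *: y); split=> [i||].
- by rewrite !mxE mulr_ge0 ?invr_ge0 ?(ltW sg0).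
- rewrite linearZ -scalemxAl -scalemxAr /= mxE [X in _ * X]mxE -/g mulrA -invfM.
  by rewrite -expr2 sqr_sqrtr ?(ltW g0) // mulVf // gt_eqF.
- by rewrite -scalemxAl yA !scalerA mulrC.
Qed.

(** * Rank-one deflation and the second eigenvalue *)

(** Two block eliminations of the same [M] leave a determinant of order [n] and one of order 1. *)
Lemma det_rank1D (K : comNzRingType) (v : 'cV[K]_n) (w : 'rV[K]_n) :
  \det (1%:M + v *m w) = 1 + (w *m v) 0 0.
Proof.
pose M := block_mx 1%:M (- w) v 1%:M : 'M[K]_(1 + n).
have d1 : \det M = \det (1%:M + v *m w).
  have : \det (block_mx 1%:M 0 (- v) 1%:M *m M) = \det (1%:M + v *m w).
    rewrite mulmx_block !mul1mx !mul0mx !mulmx1 !addr0 addNr mulNmx mulmxN opprK.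
    by rewrite det_ublock det1 mul1r addrC.
  by rewrite det_mulmx det_lblock !det1 !mul1r.
have d2 : \det M = \det (1%:M + w *m v).
  have : \det (block_mx 1%:M w 0 1%:M *m M) = \det (1%:M + w *m v).
    rewrite mulmx_block !mul1mx !mul0mx !mulmx1 !add0r addNr.
    by rewrite det_lblock det1 mulr1.
  by rewrite det_mulmx det_ublock !det1 !mul1r.
by rewrite -d1 d2 det_mx11 [LHS]mxE mxE.
Qed.

(* With [P := u^T u], both sides equal the determinant of
   [(X - a) (X - c) P + (X - A) (1 - P)]. *)
Lemma char_poly_deflate A u (a c : R) :
    (u *m u^T) 0 0 = 1 -> u *m A = a *: u ->
  ('X - a%:P) * char_poly (A - (a - c) *: (u^T *m u))
  = ('X - c%:P) * char_poly A.
Proof.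
move=> u1 uA.
pose U := map_mx polyC u; pose P := U^T *m U.
have UU : U *m U^T = 1%:M.
  rewrite /U map_trmx -map_mxM [u *m _]mx11_scalar u1 map_scalar_mx.
  by rewrite rmorph1.
have PA : P *m map_mx polyC A = a%:P *: P.
  by rewrite /P -mulmxA /U -[map_mx _ u *m _]map_mxM uA map_mxZ -scalemxAr.
have PP : P *m P = P by rewrite /P mulmxA -(mulmxA U^T) UU mulmx1.
(* [P] is a projection of rank one; this turns the linear factors into determinants. *)
have detP (b : {poly R}) : \det (1%:M + (b - 1) *: P) = b.
  by rewrite /P scalemxAl det_rank1D -scalemxAr UU !mxE mulr1 addrC subrK.
rewrite -[X in X * _]detP -[X in _ = X * _]detP /char_poly -!det_mulmx.
rewrite /char_poly_mx map_mxB map_mxZ map_mxM /= -map_trmx -/U -/P.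
congr (\det _); set Q := 'X%:M - map_mx polyC A.
have PQ : P *m Q = ('X - a%:P) *: P.
  by rewrite mulmxBr mul_mx_scalar PA scalerBl.
have -> : 'X%:M - (map_mx polyC A - (a - c)%:P *: P) = Q + (a - c)%:P *: P.
  by rewrite opprB addrA addrAC.
rewrite !mulmxDl !mul1mx mulmxDr -!scalemxAl -scalemxAr PQ PP -addrA.
congr (_ + _); rewrite !scalerA -!scalerDl rmorphB /=.
by congr (_ *: _); ring.
Qed.

(** Deflating the top eigenvalue to 0 puts [u] in the kernel of [A'], which keeps the eigenvalue
    [b > 0]. Its eigenvector is therefore orthogonal to [u], where [A'] and [A] agree, even if [b]
    equals the top eigenvalue. *)
Lemma second_eigenvector A s u : A^T = A -> eigenvalue_list A s ->
    (u *m u^T) 0 0 = 1 -> u *m A = s`_0 *: u -> 0 < s`_1 ->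
  exists v : 'rV[R]_n,
    [/\ (v *m v^T) 0 0 = 1, (u *m v^T) 0 0 = 0 & v *m A = s`_1 *: v].
Proof.
move=> symA [_ cA] u1 uA s1.
(* In a shorter list the second entry is the default 0, which positivity excludes. *)
case: s s1 cA uA => [|a [|b s]] /=; rewrite ?ltxx // => b0 cA uA.
have := char_poly_deflate 0 u1 uA; rewrite cA !big_cons subr0 mulrCA.
move=> /(mulfI (negbT (polyXsubC_eq0 a))) cA'.
set A' := A - a *: (u^T *m u) in cA'.
have uu : u *m u^T = 1%:M by rewrite [LHS]mx11_scalar u1.
have A'u : A' *m u^T = 0.
  rewrite mulmxBl -scalemxAl -mulmxA uu mulmx1.
  by rewrite -{1}symA -trmx_mul uA linearZ subrr.
have : eigenvalue A' b by rewrite eigenvalue_root_char cA' !rootM !root_XsubC eqxx orbT.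
move=> /eigenvalueP[v vA' vn0].
have vu : v *m u^T = 0.
  have : b *: (v *m u^T) = 0 by rewrite scalemxAl -vA' -mulmxA A'u mulmx0.
  by move/eqP; rewrite scaler_eq0 gt_eqF //= => /eqP.
have vA : v *m A = b *: v.
  by rewrite -vA' mulmxBr -scalemxAr mulmxA vu mul0mx scaler0 subr0.
set g := (v *m v^T) 0 0.
have g0 : 0 < g by rewrite lt_neqAle eq_sym dot_eq0 vn0 dot_ge0.
exists ((Num.sqrt g)^-1 *: v); split.
- rewrite linearZ -scalemxAl -scalemxAr /= mxE [X in _ * X]mxE -/g mulrA -invfM.
  by rewrite -expr2 sqr_sqrtr ?(ltW g0) // mulVf // gt_eqF.
- by rewrite linearZ /= -scalemxAr -[u *m v^T]trmxK trmx_mul trmxK vu trmx0 scaler0 mxE.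
- by rewrite -scalemxAl vA !scalerA mulrC.
Qed.

(* If [s`_1 < 0] then [A] is negative definite on the hyperplane orthogonal to
   [u], which contains a nonzero combination of the two unit vectors. *)
Lemma second_eigenvalue_ge0 A s u (i j : 'I_n) :
    A^T = A -> eigenvalue_list A s ->
    (u *m u^T) 0 0 = 1 -> u *m A = s`_0 *: u -> i != j ->
    A i i = 0 -> A j j = 0 -> A i j = 0 ->
  0 <= s`_1.
Proof.
move=> symA [ss cA] u1 uA ij Aii Ajj Aij.
case: s ss cA uA => [|a [|b s]] //= /andP[ab sb] cA uA.
(* Deflating to [b], not to 0, keeps [b] the largest eigenvalue of [A'] even when it is negative, so
   the Rayleigh bound holds with [b]. *)
set A' := A - (a - b) *: (u^T *m u).
have lA' : eigenvalue_list A' (b :: b :: s).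
  split; first by rewrite /= lexx.
  apply: (mulfI (negbT (polyXsubC_eq0 a))); rewrite /A' (char_poly_deflate b u1 uA) cA.
  by rewrite !big_cons mulrCA.
have symA' : A'^T = A' by rewrite /A' linearB linearZ /= trmx_mul trmxK symA.
have rl (al be : R) : - ((a - b) * (al * u 0 i + be * u 0 j) ^+ 2)
    <= b * (al ^+ 2 + be ^+ 2).
  pose z : 'rV_n := al *: delta_mx 0 i + be *: delta_mx 0 j.
  have zl (M : 'M[R]_n) k : (z *m M) 0 k = al * M i k + be * M j k.
    by rewrite mulmxDl -!scalemxAl -!rowE !mxE.
  have zr (w : 'rV[R]_n) : (w *m z^T) 0 0 = al * w 0 i + be * w 0 j.
    by rewrite linearD !linearZ /= mulmxDr -!scalemxAr !trmx_delta -!colE !mxE.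
  have A'E k l : A' k l = A k l - (a - b) * (u 0 k * u 0 l).
    by rewrite 3!mxE mxE big_ord1 mxE.
  have zi : z 0 i = al by rewrite !mxE !eqxx (negbTE ij) /= mulr1 mulr0 addr0.
  have zj : z 0 j = be by rewrite !mxE !eqxx eq_sym (negbTE ij) /= mulr1 mulr0 add0r.
  have Aji : A j i = 0 by rewrite -symA mxE.
  have := rayleigh z symA' lA'; rewrite /= !zr zi zj !zl !A'E Aii Ajj Aij Aji.
  lra.
rewrite leNgt; apply/negP => b0.
(* The combination with coefficients [u 0 j] and [- u 0 i] is orthogonal to [u], so a negative [b]
   makes both coordinates vanish; then the unit vector at [i] is itself orthogonal to [u]. *)
have u2 : u 0 i ^+ 2 + u 0 j ^+ 2 = 0.
  have := rl (u 0 j) (- u 0 i).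
  have -> : u 0 j * u 0 i + - u 0 i * u 0 j = 0 by ring.
  rewrite expr0n mulr0 oppr0 sqrrN => h.
  have := sqr_ge0 (u 0 i); have := sqr_ge0 (u 0 j); nra.
have ui : u 0 i = 0.
  apply/eqP; rewrite -sqrf_eq0; have := sqr_ge0 (u 0 i); have := sqr_ge0 (u 0 j).
  by move=> *; apply/eqP; lra.
have := rl 1 0; rewrite ui; lra.
Qed.

End Symmetric.

(** * Adjacency matrices *)

Lemma sum_card_edges (R : pzRingType) (T : finType) (e : rel T) :
    simple_graph e ->
  \sum_x \sum_(y | e x y) 1 = (2 * #|edges e|)%:R :> R.
Proof.
move=> [syme irre]; rewrite pair_big_dep /= sumr_const; congr (_%:R).
rewrite -sum1_card (partition_big (fun p => [set p.1; p.2]) (mem (edges e))) /=.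
  rewrite mulnC -sum_nat_const; apply: eq_bigr => A.
  rewrite inE => /existsP[x /existsP[y /andP[exy /eqP->]]].
  have xy : x != y by apply: contraTneq exy => ->; rewrite irre.
  rewrite -(_ : #|[set (x, y); (y, x)]| = 2%N); last first.
    by rewrite cards2 xpair_eqE (negbTE xy).
  rewrite -sum1_card; apply: eq_bigl => -[a b]; rewrite unfold_in /= !inE !xpair_eqE /=.
  apply/andP/orP => [[eab /eqP/setP ab]|].
    have ab' : a != b by apply: contraTneq eab => ->; rewrite irre.
    have := ab a; have := ab b; rewrite !inE !eqxx orbT /=.
    move=> /esym/orP[]/eqP eb /esym/orP[]/eqP ea; move: ab'; rewrite ea eb ?eqxx //=.
      by right.
    by left.
  case=> /andP[/eqP-> /eqP->]; first by rewrite exy.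
  by rewrite syme exy finset.setUC.
move=> [x y]; rewrite unfold_in /= => exy; rewrite inE.
by apply/existsP; exists x; apply/existsP; exists y; rewrite exy /=.
Qed.

Section AdjacencyForms.
Variables (R : realType) (T : finType) (e : rel T).
Implicit Types u v : 'rV[R]_#|T|.

Lemma dot_enum_rank u v :
  (u *m v^T) 0 0 = \sum_x u 0 (enum_rank x) * v 0 (enum_rank x).
Proof.
rewrite mxE (reindex (@enum_rank T)); last exact/onW_bij/enum_rank_bij.
by apply: eq_bigr => x _; rewrite mxE.
Qed.

Lemma adjmx_form u :
  (u *m adjmx e R *m u^T) 0 0
  = \sum_x \sum_(y | e x y) u 0 (enum_rank x) * u 0 (enum_rank y).
Proof.
rewrite dot_enum_rank [RHS](exchange_big_dep xpredT) //=; apply: eq_bigr => y _.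
rewrite mxE mulr_suml (reindex (@enum_rank T)); last exact/onW_bij/enum_rank_bij.
rewrite [RHS]big_mkcond /=; apply: eq_bigr => x _; rewrite mxE !enum_rankK.
by case: (e x y); rewrite ?mulr1 // mulr0 mul0r.
Qed.

(** Eigenvectors are scaled by the square roots of their eigenvalues; scaling and the adjacency form
    each contribute one factor, hence the squares. A missing edge makes the second eigenvalue
    nonnegative, as its root requires. *)
Lemma principal_pair (s : seq R) :
    (0 < #|T|)%N -> simple_graph e -> ~ complete_graph e ->
    eigenvalue_list (adjmx e R) s ->
  [/\ 0 <= s`_0, 0 <= s`_1 & exists p q : T -> R,
    [/\ forall x, 0 <= p x, \sum_x p x ^+ 2 = s`_0, \sum_x q x ^+ 2 = s`_1,
      \sum_x p x * q x = 0
    & \sum_x \sum_(y | e x y) (p x * p y + q x * q y) = s`_0 ^+ 2 + s`_1 ^+ 2]].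
Proof.
move=> T0 [syme irre] nc ls; set A := adjmx e R.
have symA : A^T = A by apply/matrixP => i j; rewrite !mxE syme.
have A0 i j : 0 <= A i j by rewrite mxE ler0n.
have [u [u0 u1 uA]] := perron T0 symA A0 ls.
have [x [y [xy nxy]]] : exists x y, x != y /\ ~~ e x y.
  apply: contrapT => no; apply: nc => x y xy; apply: contrapT => nxy.
  by apply: no; exists x, y; split=> //; apply/negP.
have s1 : 0 <= s`_1.
  apply: (second_eigenvalue_ge0 symA ls u1 uA (i := enum_rank x) (j := enum_rank y)).
  - by rewrite (inj_eq enum_rank_inj).
  - by rewrite mxE irre.
  - by rewrite mxE irre.
  - by rewrite mxE !enum_rankK (negbTE nxy).
have s01 : s`_1 <= s`_0.
  have : (1 < size s)%N.
    by rewrite (size_eigenvalue_list ls); apply/card_gt1P; exists x, y.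
  by case: ls => + _; case: (s) => [|a [|b l]] //= /andP[].
have s0 : 0 <= s`_0 := le_trans s1 s01.
(* For eigenvalue 0 the zero vector serves, so the length of [v] is prescribed only after
   multiplication by the eigenvalue. *)
have [v [v1 uv vA]] : exists v : 'rV[R]_#|T|,
    [/\ s`_1 * (v *m v^T) 0 0 = s`_1, (u *m v^T) 0 0 = 0
       & v *m A = s`_1 *: v].
  have [s1p|s1n] := ltP 0 s`_1.
    have [v [v1 uv vA]] := second_eigenvector symA ls u1 uA s1p.
    by exists v; rewrite v1 mulr1.
  have -> : s`_1 = 0 by apply/eqP; rewrite eq_le s1 s1n.
  by exists 0; split; rewrite ?mul0r ?trmx0 ?mulmx0 ?mul0mx ?scale0r ?mxE.
have form (w : 'rV[R]_#|T|) a : w *m A = a *: w ->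
    \sum_x w 0 (enum_rank x) * \sum_(y | e x y) w 0 (enum_rank y)
    = a * (w *m w^T) 0 0.
  move=> wA; transitivity ((w *m A *m w^T) 0 0).
    by rewrite adjmx_form; apply: eq_bigr => z _; rewrite mulr_sumr.
  by rewrite wA -scalemxAl mxE.
split=> //; exists (fun x => Num.sqrt s`_0 * u 0 (enum_rank x)).
exists (fun x => Num.sqrt s`_1 * v 0 (enum_rank x)); split.
- by move=> z; rewrite mulr_ge0 ?sqrtr_ge0.
- under eq_bigr do rewrite exprMn sqr_sqrtr // expr2.
  by rewrite -mulr_sumr -dot_enum_rank u1 mulr1.
- under eq_bigr do rewrite exprMn sqr_sqrtr // expr2.
  by rewrite -mulr_sumr -dot_enum_rank v1.
- under eq_bigr do rewrite mulrACA.
  by rewrite -mulr_sumr -dot_enum_rank uv mulr0.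
- under eq_bigr do under eq_bigr do
    rewrite mulrACA -expr2 sqr_sqrtr // [X in _ + X]mulrACA
      -[X in _ + X * _]expr2 sqr_sqrtr //.
  under eq_bigr do rewrite big_split /= -!mulr_sumr.
  rewrite big_split /= -!mulr_sumr (form _ _ uA) (form _ _ vA) u1 v1.
  by rewrite mulr1 !expr2.
Qed.
End AdjacencyForms.

(** * From the positive edge mass to the eigenvalue bound *)

Theorem theorem4 (R : realType) (T : finType) (e : rel T) (lambda : seq R)
    (hT : (0 < #|T|)%N)
    (hG : simple_graph e)
    (hnc : ~ complete_graph e)
    (hlambda : eigenvalue_list (adjmx e R) lambda) :
  let m := #|edges e| in
  let omega : R := (clique_number e)%:R in
  lambda`_0 ^+ 2 + lambda`_1 ^+ 2
    <= (1 - 1 / (omega + 50 * omega `^ (5 / 6))) * (2 * m%:R).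
Proof.
set m := #|edges e|; set omega : R := (clique_number e)%:R; move=> /=.
have [s0 s1 [p [q [p0 pp qq pq pqe]]]] := principal_pair hT hG hnc hlambda.
set L := _ + _ in pqe *.
have S_L : \sum_i \sum_j (p i * p j + q i * q j) ^+ 2 = L.
  by rewrite sum_sqr_dot pp qq pq expr0n mulr0 addr0.
have := @positive_edge_mass R T e p q hT hG p0; rewrite S_L big_split /= pp qq.
have hW : (lambda`_0 + lambda`_1) ^+ 2 <= 2 * L.
  by have := sqr_ge0 (lambda`_0 - lambda`_1); rewrite /L; lra.
move=> /(_ hW); rewrite -/omega; set M := \sum_i \sum_(j | e i j) _.
set K := omega + _; set c := 1 - 1 / K => hM.
have om1 : 1 <= omega by rewrite /omega ler1n clique_number_gt0.
(* This makes [c] positive, so that it can be cancelled at the end. *)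
have K1 : 1 < K.
  have : 0 < omega `^ (5 / 6) by apply/powR_gt0/(lt_le_trans ltr01).
  by rewrite /K; lra.
have c0 : 0 < c by rewrite /c subr_gt0 ltr_pdivrMr ?mul1r //; lra.
(* With [Y] the positive part of an entry [X], [2 * c * X <= 2 * c * Y <= c ^+ 2 + Y ^+ 2], summed
   over the [2 * m] ordered adjacent pairs. Together with [M <= c * L] this leaves
   [c * L <= c ^+ 2 * (2 * m)]. *)
have : 2 * c * L <= c ^+ 2 * (2 * m%:R) + M.
  rewrite -natrM -sum_card_edges // -pqe /M !mulr_sumr -big_split.
  apply: ler_sum => x _; rewrite !mulr_sumr -big_split; apply: ler_sum => y _ /=.
  set X := p x * p y + q x * q y.
  have : X <= Num.max X 0 by rewrite le_max lexx.
  have := sqr_ge0 (c - Num.max X 0); nra.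
move=> h; rewrite -(ler_pM2l c0); lra.
Qed.
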